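(* Let $0<\mu\le L$, let $f\in\mathcal{S}^1_{\mu,L}(\mathbb{R}^d)$ with minimizer $x^\star$, let $s=1/L$, let $\alpha>0$ be real and let $r$ be a real number with $r>2\alpha$. Then there exists a positive integer $K$ (written $K(\alpha,r)$) such that, for every initial point $x_0=y_0\in\mathbb{R}^d$, the sequence $\{x_k\}_{k\ge 0}$ generated by NAG-$\alpha$ with step size $s=1/L$ satisfies $$f(x_k)-f(x^\star)\le \frac{L\,\mathcal{E}(K)}{k^\alpha\left(k^\alpha+r k^{\alpha-1}\right)},\qquad \forall k\ge K,$$ where $\mathcal{E}$ is the Lyapunov function of NAG-$\alpha$ defined in the context.
   Context: $\|\cdot\|$ and $\langle\cdot,\cdot\rangle$ are the Euclidean norm and inner product on $\mathbb{R}^d$. For $0<\mu\le L$, $\mathcal{S}^1_{\mu,L}(\mathbb{R}^d)$ is the class of continuously differentiable convex functions $f:\mathbb{R}^d\to\mathbb{R}$ such that $\|\nabla f(x)-\nabla f(y)\|\le L\|x-y\|$ and $f(y)\ge f(x)+\langle\nabla f(x),y-x\rangle+\frac{\mu}{2}\|y-x\|^2$ for all $x,y\in\mathbb{R}^d$. $x^\star$ denotes the unique global minimizer of $f$. NAG-$\alpha$ with step size $s>0$ and parameters $\alpha,r$: starting from $x_0=y_0$, for $k\ge 1$, $$x_k=y_{k-1}-s\nabla f(y_{k-1}),\qquad y_k=x_k+\frac{(k-1)^\alpha}{k^\alpha+rk^{\alpha-1}}(x_k-x_{k-1}).$$ Velocity: $v_k=(x_k-x_{k-1})/\sqrt{s}$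 for $k\ge1$. Lyapunov function, for positive integers $k$ for which the expression is defined (that is, $k\ge2$ if $\alpha<1$): $$\mathcal{E}(k)=s k^\alpha(k^\alpha+rk^{\alpha-1})\left(f(x_k)-f(x^\star)\right)+\frac12\left\|\sqrt{s}\,(k-1)^\alpha v_k+r(k-1)^{\alpha-1}(x_k-x^\star)\right\|^2.$$ *)

(* Defs.v *)
From mathcomp Require Import all_boot all_order all_algebra.
From mathcomp Require Import all_classical all_reals all_analysis.

Set Implicit Arguments.
Unset Strict Implicit.
Unset Printing Implicit Defensive.

Import Order.TTheory GRing.Theory Num.Theory.
Import numFieldNormedType.Exports.

Local Open Scope classical_set_scope.
Local Open Scope ring_scope.

(* The library norm on ['rV[R]_d] is the sup norm, so the Euclidean inner
   product and norm are defined here.  Both norms induce the same topology, so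
   the library's [differentiable] and [continuous] have their usual meaning. *)
Definition inner (R : realType) (d : nat) (u v : 'rV[R]_d) : R :=
  \sum_(i < d) u 0 i * v 0 i.

Definition enorm (R : realType) (d : nat) (u : 'rV[R]_d) : R :=
  Num.sqrt (inner u u).

Definition grad (R : realType) (d : nat) (f : 'rV[R]_d -> R) (x : 'rV[R]_d) :
    'rV[R]_d :=
  \row_(i < d) 'D_(delta_mx 0 i) f x.

Record strongly_convex_smooth (R : realType) (d : nat) (mu L : R)
    (f : 'rV[R]_d -> R) : Prop := StronglyConvexSmooth {
  scs_differentiable : forall x : 'rV[R]_d, differentiable f x;
  scs_grad_continuous : continuous (grad f);
  scs_convex : convex_function [set: convex_lmodType 'rV[R]_d] f;
  scs_grad_lipschitz : forall x y : 'rV[R]_d,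
    enorm (grad f x - grad f y) <= L * enorm (x - y);
  scs_strongly_convex : forall x y : 'rV[R]_d,
    f x + inner (grad f x) (y - x) + mu / 2 * enorm (y - x) ^+ 2 <= f y
}.

Definition global_minimizer (R : realType) (d : nat) (f : 'rV[R]_d -> R)
    (xstar : 'rV[R]_d) : Prop :=
  forall x : 'rV[R]_d, f xstar <= f x.

Definition nag_weight (R : realType) (a r : R) (k : nat) : R :=
  k%:R `^ a + r * k%:R `^ (a - 1).

(* Every initial point [x 0 = y 0] determines exactly one pair [(x, y)]. *)
Definition nag_alpha (R : realType) (d : nat) (f : 'rV[R]_d -> R) (s a r : R)
    (x y : nat -> 'rV[R]_d) : Prop :=
  [/\ x 0%N = y 0%N,
      forall k : nat, (1 <= k)%N -> x k = y k.-1 - s *: grad f (y k.-1)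
    & forall k : nat, (1 <= k)%N ->
        y k = x k + (k.-1%:R `^ a / nag_weight a r k) *: (x k - x k.-1)].

Definition velocity (R : realType) (d : nat) (s : R) (x : nat -> 'rV[R]_d)
    (k : nat) : 'rV[R]_d :=
  (Num.sqrt s)^-1 *: (x k - x k.-1).

(* Only meaningful for [1 <= k], and for [2 <= k] when [a < 1]: in the library
   [0 `^ (a - 1)] is 0 for every [a != 1], including the negative exponents,
   and [0 `^ 0 = 1]. *)
Definition lyapunov (R : realType) (d : nat) (f : 'rV[R]_d -> R)
    (xstar : 'rV[R]_d) (s a r : R) (x : nat -> 'rV[R]_d) (k : nat) : R :=
  s * k%:R `^ a * nag_weight a r k * (f (x k) - f xstar)
  + 2^-1 * enorm ((Num.sqrt s * k.-1%:R `^ a) *: velocity s x k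
                  + (r * k.-1%:R `^ (a - 1)) *: (x k - xstar)) ^+ 2.

(* Main.v *)
Require Import Defs.
From mathcomp Require Import all_boot all_order all_algebra.
From mathcomp Require Import all_classical all_reals all_analysis.
From mathcomp Require Import ring lra.

(** The Lyapunov function E is nonincreasing from some index on, and its first
    summand alone is [L^-1 * k^a * w_k * (f x_k - f xstar)] with
    [w_k = k^a + r k^(a-1)], so [E k <= E K] is the announced bound.

    Put [s = 1/L], [g = grad f (y_k)], [p = y_k - x_k], [u = x_k - xstar],
    [b = r k^(a-1)] and [c = r (k-1)^(a-1)].  The recursion says
    [(k-1)^a (x_k - x_{k-1}) = w_k p], hence the vector inside the norm of
    [E k] is [w_k p + c u], and the one inside [E (k+1)] is
    [w_k p + b u - s w_k g].  Going from k to k+1 thus does two things.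

    - The gradient term.  The descent inequality for [x_{k+1} = y_k - s g] and
      strong convexity at [y_k] towards [x_k] and towards [xstar],
      with weights [w_k], [k^a] and [b], give a decrease as soon as
      [(k+1)^a w_{k+1} <= w_k^2], with the bonus
      [s w_k mu/2 (k^a |p|^2 + b |p + u|^2)] left over.  The weight inequality
      follows from [(1 + 1/k)^(2a) <= 1 + r/k], true for large k because
      [2a < r] ([nag_weight_succ_le]).

    - The drift of the coefficient of u from c to b, which is absent when
      [a = 1].  It costs a quadratic form in p and u of size
      [|b - c| w_k (|p|^2 + |p + u|^2)].  Since [(1 - 1/k)^(a-1)] tends to 1,
      [|b - c|] is eventually a small fraction of [b <= k^a], and the strong
      convexity bonus absorbs this cost ([drift_le]).

    Both conditions on k involve only a, r, mu and L
    ([eventually_regular_weights]), so K does not depend on the initial point. *)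

Import Order.TTheory GRing.Theory Num.Theory.
Import numFieldNormedType.Exports.

Local Open Scope ring_scope.

(** * The Euclidean inner product *)

Section EuclideanInner.
Context {R : realType} {d : nat}.
Implicit Types (u v w : 'rV[R]_d) (c : R).

Lemma innerC u v : inner u v = inner v u.
Proof. by apply: eq_bigr => i _; rewrite mulrC. Qed.

Lemma innerDl u v w : inner (u + v) w = inner u w + inner v w.
Proof.
by rewrite /inner -big_split /=; apply: eq_bigr => i _; rewrite mxE mulrDl.
Qed.

Lemma innerZl c u v : inner (c *: u) v = c * inner u v.
Proof.
by rewrite /inner mulr_sumr; apply: eq_bigr => i _; rewrite mxE mulrA.
Qed.

Lemma innerDr u v w : inner w (u + v) = inner w u + inner w v.
Proof. by rewrite innerC innerDl !(innerC w). Qed.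

Lemma innerZr c u v : inner u (c *: v) = c * inner u v.
Proof. by rewrite innerC innerZl innerC. Qed.

Lemma innerNl u v : inner (- u) v = - inner u v.
Proof. by rewrite -scaleN1r innerZl mulN1r. Qed.

Lemma innerNr u v : inner u (- v) = - inner u v.
Proof. by rewrite innerC innerNl innerC. Qed.

Definition innerE := (innerDl, innerDr, innerNl, innerNr, innerZl, innerZr).

Lemma inner_ge0 u : 0 <= inner u u.
Proof. by apply: sumr_ge0 => i _; rewrite -expr2 sqr_ge0. Qed.

Lemma enorm_sq u : enorm u ^+ 2 = inner u u.
Proof. by rewrite sqr_sqrtr ?inner_ge0. Qed.

(** Expansion of the square of [u - c *: v]. *)
Lemma inner_young c u v : 0 < c ->
  2 * inner u v <= c^-1 * inner u u + c * inner v v.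
Proof.
move=> c0; have : 0 <= c^-1 * inner (u - c *: v) (u - c *: v).
  by rewrite mulr_ge0 ?invr_ge0 ?inner_ge0 ?ltW.
rewrite !innerE (innerC v u) -[2 * _ <= _]subr_ge0 => /le_trans; apply.
by rewrite le_eqVlt; apply/orP; left; apply/eqP; field; rewrite gt_eqF.
Qed.

End EuclideanInner.

(** * Descent along a gradient step *)

Section Smoothness.
Local Open Scope classical_set_scope.
Local Open Scope ring_scope.
Context {R : realType} {d : nat} {mu L : R} {f : 'rV[R]_d -> R}.
Context (mu_gt0 : 0 < mu) (L_gt0 : 0 < L).
Context (hf : strongly_convex_smooth mu L f).

Lemma tangent_le x y : f x + inner (grad f x) (y - x) <= f y.
Proof.
have := scs_strongly_convex hf x y; rewrite enorm_sq.
have : 0 <= mu / 2 * inner (y - x) (y - x).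
  by rewrite mulr_ge0 ?inner_ge0// divr_ge0// ltW.
lra.
Qed.

(** Young's inequality with the parameter [L] balances its two terms, so it
    does here what Cauchy-Schwarz would do. *)
Lemma grad_increment_inner_le x h :
  inner (grad f (x + h) - grad f x) h <= L * inner h h.
Proof.
have Lip : inner (grad f (x + h) - grad f x) (grad f (x + h) - grad f x)
    <= L ^+ 2 * inner h h.
  rewrite -!enorm_sq -exprMn lerXn2r ?nnegrE ?mulr_ge0 ?sqrtr_ge0 ?(ltW L_gt0)//.
  have := scs_grad_lipschitz hf (x + h) x.
  by rewrite [x + h - x]addrAC subrr add0r.
have := inner_young L (grad f (x + h) - grad f x) h L_gt0.
have : L^-1 * inner (grad f (x + h) - grad f x) (grad f (x + h) - grad f x)
    <= L * inner h h.
  rewrite mulrC ler_pdivrMr//; apply: le_trans Lip _; rewrite expr2; lra.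
lra.
Qed.

(** The quadratic upper bound without any integration.  Convexity alone gives
    the constant [L] instead of [L / 2].  Applying a bound with constant [C] to
    the two halves of the segment from [x] to [x + h], and comparing the
    gradient at the midpoint with that at [x], yields the bound with constant
    [C / 2 + L / 4]; the iterates of this map tend to its fixed point [L / 2]. *)
Lemma upper_dyadic n x h :
  f (x + h) <= f x + inner (grad f x) h
    + L / 2 * (1 + 2^-1 ^+ n) * inner h h.
Proof.
elim: n x h => [|n IH] x h.
  have := tangent_le (x + h) x; have := grad_increment_inner_le x h.
  have -> : x - (x + h) = - h by rewrite opprD addrA subrr add0r.
  rewrite !innerE expr0; lra.
have := IH (x + 2^-1 *: h) (2^-1 *: h); have := IH x (2^-1 *: h).
have := grad_increment_inner_le x (2^-1 *: h).
have -> : x + 2^-1 *: h + 2^-1 *: h = x + h.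
  rewrite -addrA -scalerDl (_ : 2^-1 + 2^-1 = 1) ?scale1r//; lra.
rewrite !innerE exprS; lra.
Qed.

Lemma quadratic_upper_bound x h :
  f (x + h) <= f x + inner (grad f x) h + L / 2 * inner h h.
Proof.
set B := L / 2 * inner h h.
have cvgB : (f x + inner (grad f x) h + B + B * 2^-1 ^+ n)%R
    @[n --> \oo] --> f x + inner (grad f x) h + B.
  rewrite -[X in _ --> X]addr0; apply: cvgD; first exact: cvg_cst.
  rewrite -[X in _ --> X](mulr0 B); apply: cvgM; first exact: cvg_cst.
  by apply: cvg_expr; rewrite ger0_norm; lra.
apply: (cvgr_to_ge cvgB); apply: nearW => n.
by apply: le_trans (upper_dyadic n x h) _; rewrite /B; lra.
Qed.

(** The step [L^-1] minimizes the quadratic upper bound along [- grad f x]. *)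
Lemma gradient_step_descent x :
  f (x - L^-1 *: grad f x) <= f x - L^-1 / 2 * inner (grad f x) (grad f x).
Proof.
apply: le_trans (quadratic_upper_bound _ _) _.
rewrite !innerE le_eqVlt; apply/orP; left; apply/eqP.
by field; rewrite gt_eqF.
Qed.

End Smoothness.

(** * Asymptotics of the weights *)

Section Weights.
Local Open Scope classical_set_scope.
Local Open Scope ring_scope.
Context {R : realType}.
Implicit Types (a b c r e : R) (k : nat).

Lemma natr_powRB1 a k : (0 < k)%N -> k%:R `^ (a - 1) = k%:R `^ a / k%:R :> R.
Proof.
by move=> k0; rewrite powRB ?powRr1// pnatr_eq0 -lt0n k0 implybT.
Qed.

Lemma nag_weightE a r k : (0 < k)%N ->
  nag_weight a r k = k%:R `^ a * (1 + r / k%:R).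
Proof. by move=> k0; rewrite /nag_weight natr_powRB1//; ring. Qed.

(** With [t = 1 / k]: [(1 + t)^b <= exp (b t) <= 1 / (1 - b t)], and
    [1 <= (1 + r t) (1 - b t)] as soon as [r b t <= r - b]. *)
Lemma ler_powR_succ b r k : 0 < b -> b < r -> r * b / (r - b) <= k%:R ->
  k.+1%:R `^ b <= k%:R `^ b * (1 + r / k%:R) :> R.
Proof.
move=> b0 br; rewrite ler_pdivrMr ?subr_gt0// => hk.
have r0 : 0 < r by lra.
have k0 : 0 < k%:R :> R by nra.
have bk : b < k%:R by nra.
have kV : k%:R * k%:R^-1 = 1 :> R by rewrite divff// gt_eqF.
have kV0 : 0 < k%:R^-1 :> R by rewrite invr_gt0.
have -> : k.+1%:R = k%:R * (1 + k%:R^-1) :> R by rewrite -natr1 mulrDr mulr1 kV.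
rewrite powRM ?(ltW k0) ?addr_ge0 ?(ltW kV0)// ler_pM2l ?powR_gt0//.
have hexp : (1 + k%:R^-1) `^ b <= expR (b / k%:R).
  rewrite /powR gt_eqF ?addr_gt0// ler_expR ler_pM2l//.
  by apply: le_ln1Dx; lra.
apply: le_trans hexp _.
have hb : 0 < 1 - b / k%:R by rewrite subr_gt0 ltr_pdivrMr// mul1r.
rewrite -[expR _]invrK -expRN.
apply: (@le_trans _ _ (1 - b / k%:R)^-1).
  by rewrite lef_pV2 ?posrE ?expR_gt0// expR_ge1Dx.
rewrite -[_^-1]mul1r ler_pdivrMr//.
set t := k%:R^-1 in kV kV0 *.
have : r * b * t <= r - b by nra.
nra.
Qed.

(** The right-hand side is [k^(2a) (1 + r/k)^2].  One factor [1 + r/k] dominates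
    the factor [1 + r/(k+1)] of the left-hand side, the other one pays for
    passing from [k^(2a)] to [(k+1)^(2a)]. *)
Lemma nag_weight_succ_le a r k : 0 < a -> 2 * a < r ->
  r * (2 * a) / (r - 2 * a) <= k%:R ->
  k.+1%:R `^ a * nag_weight a r k.+1 <= nag_weight a r k ^+ 2.
Proof.
move=> a0 ar hk.
have k0 : (0 < k)%N.
  rewrite -(ltr0n R); apply: lt_le_trans hk.
  by rewrite divr_gt0 ?mulr_gt0 ?subr_gt0//; lra.
have kR : 0 < k%:R :> R by rewrite ltr0n.
have r0 : 0 < r by lra.
have k_kS : r / k.+1%:R <= r / k%:R.
  by rewrite ler_pM2l// lef_pV2 ?posrE ?ltr0n// ler_nat.
have := ler_powR_succ (2 * a) r k _ ar hk.
rewrite !nag_weightE// [2 * a]mulrC !powRrM.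
rewrite (powR_mulrn 2) ?powR_ge0// (powR_mulrn 2) ?powR_ge0// => /(_ _)P.
have {}P := P ltac:(lra).
have ratio_ge0 : 0 <= 1 + r / k.+1%:R by rewrite addr_ge0// divr_ge0// ltW.
have := ler_pM (sqr_ge0 _) ratio_ge0 P (_ : _ <= 1 + r / k%:R).
rewrite lerD2l => /(_ k_kS); move: (r / _) (r / _) (_ `^ a) (_ `^ a).
by move=> ? ? ? ?; lra.
Qed.

(** The ratio of the two powers is [(1 - 1 / k)^c], and [t |-> t^c] is
    continuous at 1 whatever the sign of [c]. *)
Lemma near_powR_pred_close c e : 0 < e ->
  \forall k \near \oo, `|k%:R `^ c - k.-1%:R `^ c| <= e * k%:R `^ c.
Proof.
move=> e0.
have cvg_ratio : (1 - harmonic n : R) @[n --> \oo] --> (1 : R).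
  rewrite -[X in _ --> X]subr0; apply: cvgB; first exact: cvg_cst.
  exact: cvg_harmonic.
have ctn1 : {for 1, continuous (fun t : R => t `^ c)}.
  apply: differentiable_continuous; apply/derivable1_diffP.
  by apply: derivable_powR; rewrite in_itv/= ltr01.
have cvg_pow : (1 - harmonic n : R) `^ c @[n --> \oo] --> (1 : R).
  have one_powR : (1 : R) `^ c = 1 by rewrite powR1.
  rewrite -[X in _ --> X]one_powR.
  exact: continuous_cvg ctn1 cvg_ratio.
have /cvgrPdist_le/(_ e e0)[N _ HN] := cvg_pow.
(* The harmonic sequence starts at [1 / 1], hence the shift by one. *)
exists N.+1 => // -[//|k] /= Nk.
have kS : 0 < k.+1%:R :> R by rewrite ltr0n.
have -> : k%:R = k.+1%:R * (1 - k.+1%:R^-1) :> R.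
  by rewrite mulrBr mulr1 divff ?gt_eqF// -natr1 addrK.
rewrite powRM ?(ltW kS)// ?subr_ge0 ?invf_le1 ?ler1n//.
rewrite -[X in X - _]mulr1 -mulrBr normrM ger0_norm ?powR_ge0// mulrC.
rewrite ler_wpM2r ?powR_ge0//.
exact: HN.
Qed.

(** The condition [r <= k] means [r * k^(a - 1) <= k^a], which lets one bound on
    the drift serve both terms of the strong convexity bonus. *)
Lemma eventually_regular_weights a r e : 0 < a -> 2 * a < r -> 0 < e ->
  exists N, forall k, (N <= k)%N ->
    [/\ (2 <= k)%N, r <= k%:R,
        k.+1%:R `^ a * nag_weight a r k.+1 <= nag_weight a r k ^+ 2
      & `|k%:R `^ (a - 1) - k.-1%:R `^ (a - 1)| <= e * k%:R `^ (a - 1)].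
Proof.
move=> a0 ar e0.
suff [N _ HN] : \forall k \near \oo, [/\ (2 <= k)%N, r <= k%:R,
    k.+1%:R `^ a * nag_weight a r k.+1 <= nag_weight a r k ^+ 2
  & `|k%:R `^ (a - 1) - k.-1%:R `^ (a - 1)| <= e * k%:R `^ (a - 1)].
  by exists N => k /HN.
near=> k; split; near: k.
- exact: nbhs_infty_ge.
- exact: nbhs_infty_ger.
- apply: filterS (nbhs_infty_ger (r * (2 * a) / (r - 2 * a))) => k.
  exact: nag_weight_succ_le.
- exact: near_powR_pred_close.
Unshelve. all: by end_near. Qed.

End Weights.

(** * Monotonicity of the Lyapunov function *)

Section Lyapunov.
Context {R : realType}.

(** [P], [U] and [pu] stand for [|p|^2], [|u|^2] and [<p, u>].  The left-hand
    side is half the difference of the squared norms of [w p + b u] and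
    [w p + c u]; the right-hand side is what strong convexity provides, [m]
    being [mu / L].  The hypotheses on [P], [U], [pu] are the nonnegativity of
    the squared norms of [p], [u], [p + u] and [2 p + u]; they imply that [U]
    and [|pu|] are at most twice [P + Q], where [Q = |p + u|^2]. *)
Lemma drift_le (w b c m A P U pu : R) : 0 <= b <= A -> w = A + b -> 0 <= m ->
  0 <= P -> 0 <= U -> 0 <= P + 2 * pu + U -> 0 <= 4 * P + 4 * pu + U ->
  `|b - c| * 8 <= m * b ->
  ((b ^+ 2 - c ^+ 2) * U + 2 * w * (b - c) * pu) / 2
  <= w * (m / 2) * (A * P + b * (P + 2 * pu + U)).
Proof.
move=> /andP[b0 bA] wE m0 P0 U0 Q0 S0 hbc.
set Q := P + 2 * pu + U in Q0 *; set D := `|b - c| in hbc *.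
have D0 : 0 <= D by exact: normr_ge0.
have w0 : 0 <= w by lra.
have PQ0 : 0 <= P + Q by rewrite addr_ge0.
have U_le : U <= 2 * (P + Q) by rewrite /Q; lra.
have pu_le : `|pu| <= 2 * (P + Q).
  by move: Q0; rewrite /Q ler_norml => ?; apply/andP; split; lra.
have hpu : (b - c) * pu <= D * (2 * (P + Q)).
  apply: le_trans (ler_norm _) _.
  by rewrite normrM ler_wpM2l.
have hU : (b ^+ 2 - c ^+ 2) * U <= 2 * w * (D * (2 * (P + Q))).
  have -> : b ^+ 2 - c ^+ 2 = 2 * b * (b - c) - (b - c) ^+ 2 by ring.
  have h1 : (b - c) * U <= D * (2 * (P + Q)).
    by apply: (@le_trans _ _ (D * U)); rewrite ?ler_wpM2r ?ler_wpM2l ?ler_norm.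
  have h2 : 0 <= (b - c) ^+ 2 * U by rewrite mulr_ge0 ?sqr_ge0.
  have h3 : b * (D * (2 * (P + Q))) <= w * (D * (2 * (P + Q))).
    by apply: ler_wpM2r; [rewrite !mulr_ge0|lra].
  have := ler_wpM2l b0 h1; lra.
have m_le : D * 8 * (P + Q) <= m * (A * P + b * Q).
  apply: (@le_trans _ _ (m * b * (P + Q))).
    exact: ler_wpM2r.
  by rewrite -mulrA ler_wpM2l// mulrDr lerD2r ler_wpM2r.
have := ler_wpM2l w0 m_le; have := ler_wpM2l w0 hpu; lra.
Qed.

Context {d : nat} {mu L : R} {f : 'rV[R]_d -> R} {xstar : 'rV[R]_d}.
Context (mu_gt0 : 0 < mu) (L_gt0 : 0 < L).
Context (hf : strongly_convex_smooth mu L f).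
Context (hxstar : global_minimizer f xstar).
Context {a r : R}.

(** Eliminates the velocity: the two factors [sqrt s] cancel. *)
Lemma lyapunovE (s : R) (x : nat -> 'rV[R]_d) (k : nat) : 0 < s ->
  lyapunov f xstar s a r x k
  = s * k%:R `^ a * nag_weight a r k * (f (x k) - f xstar)
    + 2^-1 * enorm (k.-1%:R `^ a *: (x k - x k.-1)
                    + (r * k.-1%:R `^ (a - 1)) *: (x k - xstar)) ^+ 2.
Proof.
move=> s0; rewrite /lyapunov /velocity scalerA.
rewrite [Num.sqrt s * _ / _]mulrAC divff ?mul1r//.
by rewrite gt_eqF ?sqrtr_gt0.
Qed.

(** The decrease is [drift_le] added to the sum of the descent inequality and
    the two strong convexity inequalities, with the weights given in the
    introduction, after expansion of all squared norms into inner products of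
    [p], [u] and [g]. *)
Lemma lyapunov_decreases (x y : nat -> 'rV[R]_d) (k : nat) : (0 < k)%N ->
  0 < r -> r <= k%:R ->
  nag_alpha f L^-1 a r x y ->
  k.+1%:R `^ a * nag_weight a r k.+1 <= nag_weight a r k ^+ 2 ->
  `|k%:R `^ (a - 1) - k.-1%:R `^ (a - 1)|
    <= L^-1 * mu / 8 * k%:R `^ (a - 1) ->
  lyapunov f xstar L^-1 a r x k.+1 <= lyapunov f xstar L^-1 a r x k.
Proof.
move=> k0 r0 rk [_ xS yE] hweight hclose.
have s0 : 0 < L^-1 by rewrite invr_gt0.
have kR : 0 < k%:R :> R by rewrite ltr0n.
rewrite !lyapunovE//= !enorm_sq.
set s := L^-1 in s0 hclose xS *.
set A := k%:R `^ a; set w := nag_weight a r k in hweight *.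
set b := r * k%:R `^ (a - 1); set c := r * k.-1%:R `^ (a - 1).
have wE : w = A + b by [].
have A0 : 0 < A by exact: powR_gt0.
have b0 : 0 < b by rewrite mulr_gt0 ?powR_gt0.
have w0 : 0 < w by rewrite wE addr_gt0.
have bA : b <= A.
  have -> : A = k%:R * k%:R `^ (a - 1).
    by rewrite natr_powRB1// mulrC divfK ?gt_eqF.
  by rewrite ler_pM2r ?powR_gt0.
have hbc : `|b - c| * 8 <= s * mu * b.
  rewrite /b /c -mulrBr normrM gtr0_norm//.
  have := ler_wpM2l (ltW r0) hclose; lra.
set p := y k - x k; set u := x k - xstar; set g := grad f (y k).
have xSE : x k.+1 = y k - s *: g by rewrite xS.
have momentum : k.-1%:R `^ a *: (x k - x k.-1) = w *: p.
  by rewrite /p yE// addrAC subrr add0r scalerA mulrC divfK ?gt_eqF.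
have -> : x k.+1 - x k = p - s *: g by rewrite xSE /p addrAC.
have -> : x k.+1 - xstar = p + u - s *: g.
  by rewrite xSE /p /u subrKA addrAC.
rewrite momentum.
have H1 := scs_strongly_convex hf (y k) (x k).
have H2 := scs_strongly_convex hf (y k) xstar.
have H3 := gradient_step_descent mu_gt0 L_gt0 hf (y k).
rewrite -[L^-1]/s -/g -xSE in H3.
have H4 := hxstar (x k.+1).
rewrite -/g -opprB -/p enorm_sq in H1.
rewrite -/g -opprB -[y k - xstar](subrKA (x k)) -/p -/u enorm_sq in H2.
have P0 := inner_ge0 p; have U0 := inner_ge0 u.
have Q0 := inner_ge0 (p + u); have S0 := inner_ge0 (2 *: p + u).
(* Forgetting what p, u, g are keeps the expansion from going inside them. *)
clearbody p u g; rewrite !innerE in H1.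
rewrite !innerE ?(innerC u p) ?(innerC p g) ?(innerC u g) in H2 Q0 S0 *.
have drift := drift_le w b c (s * mu) A (inner p p) (inner u u) (inner p u).
have bA' : 0 <= b <= A by rewrite ltW.
have {}drift := drift bA' wE (mulr_ge0 (ltW s0) (ltW mu_gt0)) P0 U0
  ltac:(lra) ltac:(lra) hbc.
have potential : s * k.+1%:R `^ a * nag_weight a r k.+1 * (f (x k.+1) - f xstar)
    <= s * w ^+ 2 * (f (x k.+1) - f xstar).
  apply: ler_wpM2r; first by rewrite subr_ge0.
  by rewrite -mulrA ler_pM2l.
apply: le_trans (lerD potential (lexx _)) _.
have sw0 : 0 <= s * w by exact: mulr_ge0 (ltW s0) (ltW w0).
(* The values of f at [y k] cancel because [w = A + b]; the inner products with
   g cancel those of the expanded norm of [w p + b u - s w g]. *)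
have K1 := ler_wpM2l (mulr_ge0 sw0 (ltW A0)) H1.
have K2 := ler_wpM2l (mulr_ge0 sw0 (ltW b0)) H2.
have K3 := ler_wpM2l (mulr_ge0 sw0 (ltW w0)) H3.
move: K1 K2 K3 drift; rewrite wE.
move: (inner p p) (inner u u) (inner p u) (inner g p) (inner g u) (inner g g).
move: (f _) (f _) (f _) (f _) => *.
lra.
Qed.

End Lyapunov.

Theorem corollary3p3 (R : realType) (d : nat) (mu L : R)
    (mu_gt0 : 0 < mu) (mu_le_L : mu <= L)
    (f : 'rV[R]_d -> R) (hf : strongly_convex_smooth mu L f)
    (xstar : 'rV[R]_d) (hxstar : global_minimizer f xstar)
    (alpha r : R) (alpha_gt0 : 0 < alpha) (hr : 2 * alpha < r) :
  exists K : nat,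
    [/\ (0 < K)%N,
        alpha < 1 -> (2 <= K)%N
      & forall x y : nat -> 'rV[R]_d,
          nag_alpha f L^-1 alpha r x y ->
          forall k : nat, (K <= k)%N ->
            f (x k) - f xstar <=
            L * lyapunov f xstar L^-1 alpha r x K
              / (k%:R `^ alpha * (k%:R `^ alpha + r * k%:R `^ (alpha - 1)))].
Proof.
have L_gt0 : 0 < L by exact: lt_le_trans mu_le_L.
have r_gt0 : 0 < r by lra.
have e_gt0 : 0 < L^-1 * mu / 8 by rewrite !mulr_gt0 ?invr_gt0.
have [N HN] := eventually_regular_weights alpha r _ alpha_gt0 hr e_gt0.
have [N2 _ _ _] := HN N (leqnn N).
exists N; split=> [|_|x y hxy k Nk]; [exact: ltnW | exact: N2 |].
have mono :
  lyapunov f xstar L^-1 alpha r x k <= lyapunov f xstar L^-1 alpha r x N.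
  elim: k Nk => [|k IH]; first by rewrite leqn0 => /eqP ->.
  rewrite leq_eqVlt => /predU1P[<- //|]; rewrite ltnS => Nk.
  apply: le_trans (IH Nk); have [k2 rk hw hc] := HN k Nk.
  exact: (lyapunov_decreases mu_gt0 L_gt0 hf hxstar x y k (ltnW k2) r_gt0 rk
    hxy hw hc).
have [k2 _ _ _] := HN k Nk.
have kR : 0 < k%:R :> R by rewrite ltr0n ltnW.
rewrite -/(nag_weight alpha r k).
have w0 : 0 < k%:R `^ alpha * nag_weight alpha r k.
  by rewrite mulr_gt0 ?addr_gt0 ?mulr_gt0 ?powR_gt0.
rewrite ler_pdivlMr// -ler_pdivrMl//; apply: le_trans mono.
rewrite [_ * (_ * nag_weight _ _ _)]mulrC mulrA /lyapunov mulrA lerDl.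
by rewrite mulr_ge0 ?invr_ge0 ?sqr_ge0.
Qed.
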